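(* Let $\mathcal{H}$ be a real Hilbert space, $C\subseteq\mathcal{H}$ nonempty, closed and convex, and $F:\mathcal{H}\to\mathcal{H}$ a mapping such that: (1) the solution set $SOL(C,F)=\{x^*\in C : \langle F(x^* ),x-x^*\rangle\ge 0 \text{ for all } x\in C\}$ is nonempty; (2) $F$ is monotone on $C$: $\langle F(x)-F(y),x-y\rangle\ge 0$ for all $x,y\in C$; (3) $F$ is Lipschitz continuous on $C$ with constant $L>0$: $\|F(x)-F(y)\|\le L\|x-y\|$ for all $x,y\in C$. Then the sequence $\{x^k\}_{k=0}^\infty$ generated by the extragradient method with outer perturbations (described in the context, with summable perturbations) converges weakly to a solution of the variational inequality, i.e. to a point of $SOL(C,F)$.
   Context: $P_C$ denotes the metric projection of $\mathcal{H}$ onto $C$. Extragradient method with outer perturbations. Fix $\sigma>0$, $\rho\in(0,1)$, $\mu\in(0,1)$, and perturbation vectors $e_1^k=e_1(x^k)\in\mathcal{H}$, $e_2^k=e_2(x^k)\in\mathcal{H}$ ($k\ge 0$) with $\sum_{k=0}^\infty\|e_i^k\|<+\infty$ for $i=1,2$. Choose $x^0\in C$. Given $x^k$, compute $$y^k=P_C\big(x^k-\gamma_kF(x^k)+e_1^k\big),$$ where $\gamma_k=\sigma\rho^{m_k}$ and $m_k$ is the smallest nonnegative integer such that (with $y^k$ computed using this $\gamma_k$) $$\gamma_k\|F(x^k)-F(y^k)\|\le\mu\|x^k-y^k\|,$$ and then $$x^{k+1}=P_C\big(x^k-\gamma_kF(y^k)+e_2^k\big).$$ The method stops if $x^k=y^k$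 and otherwise continues with $k+1$; the statement concerns an infinite generated sequence. *)

(* Defs.v *)
From HB Require Import structures.
From mathcomp Require Import all_boot all_order all_algebra.
From mathcomp Require Import all_classical all_reals all_analysis.

Set Implicit Arguments.
Unset Strict Implicit.
Unset Printing Implicit Defensive.

Import Order.TTheory GRing.Theory Num.Theory.
Import numFieldNormedType.Exports.

Local Open Scope classical_set_scope.
Local Open Scope ring_scope.

(* A real Hilbert space is rendered as a complete normed module H over a
   realType together with a symmetric positive definite bilinear form on H
   that induces the norm of H. *)
Definition induces_norm (R : realType) (H : completeNormedModType R)
    (ip : {dot H for idfun}) : Prop :=
  forall x : H, ip x x = `|x| ^+ 2.

Section VariationalInequality.
Variables (R : realType) (H : completeNormedModType R).
Variable ip : {dot H for idfun}.
Implicit Types (C : set H) (F : H -> H).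

Definition VI_sol C F : set H :=
  [set p | C p /\ forall z, C z -> 0 <= ip (F p) (z - p)].

Definition monotone_on C F : Prop :=
  forall x y, C x -> C y -> 0 <= ip (F x - F y) (x - y).

End VariationalInequality.

Section Extragradient.
Variables (R : realType) (H : completeNormedModType R).
Implicit Types (C : set H) (F : H -> H) (sigma rho mu : R) (u x e p : H).

(* The default value 0 is only reached when u has no nearest point in C,
   which does not happen for C nonempty, closed and convex in a Hilbert
   space. *)
Definition metric_proj C u : H :=
  xget 0 [set p | C p /\ forall z, C z -> `|u - p| <= `|u - z|].

Definition eg_stepsize sigma rho (m : nat) : R := sigma * rho ^+ m.

Definition eg_trial C F sigma rho x e (m : nat) : H :=
  metric_proj C (x - eg_stepsize sigma rho m *: F x + e).

Definition eg_accept C F sigma rho mu x e (m : nat) : bool :=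
  eg_stepsize sigma rho m * `|F x - F (eg_trial C F sigma rho x e m)|
  <= mu * `|x - eg_trial C F sigma rho x e m|.

(* One iteration from x to x', with outer perturbations e1 and e2. The
   condition x != y says that the method does not stop at this iteration. *)
Definition eg_step C F sigma rho mu e1 e2 x x' : Prop :=
  exists m : nat,
    let y := eg_trial C F sigma rho x e1 m in
    [/\ eg_accept C F sigma rho mu x e1 m,
        forall j, (j < m)%N -> ~~ eg_accept C F sigma rho mu x e1 j,
        x != y
      & x' = metric_proj C (x - eg_stepsize sigma rho m *: F y + e2)].

Definition eg_generated C F sigma rho mu (e1 e2 x : nat -> H) : Prop :=
  C (x 0%N) /\
  forall k, eg_step C F sigma rho mu (e1 k) (e2 k) (x k) (x k.+1).

Definition summable_norms (e : nat -> H) : Prop := cvgn [normed series e].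

Definition weakly_cvg (x : nat -> H) p : Prop :=
  forall f : {linear H -> R^o}, continuous f -> f (x k) @[k --> \oo] --> f p.

End Extragradient.

(* Main.v *)
Require Import Defs.
From HB Require Import structures.
From mathcomp Require Import all_boot all_order all_algebra.
From mathcomp Require Import all_classical all_reals all_analysis.
From mathcomp Require Import ring lra.

(* Let D_k = |x^k - y^k| and let p be a solution. The projection inequalities at
   y^k and x^(k+1), monotonicity and the line search give
   |x^(k+1)-p|^2 + (1-mu) D_k^2
     <= |x^k-p|^2 + |e_1^k|^2/(1-mu) + 2 |e_2^k| |x^(k+1)-p|.
   Hence |x^(k+1)-p| exceeds |x^k-p| by at most a summable quantity, so |x^k-p|
   converges, and then D_k tends to 0. Weak cluster points are taken along
   ultrafilters: the inner products <x^k,h> converge along any ultrafilter, to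
   a bounded functional of h represented by a vector by Riesz's theorem. As the
   stepsizes are bounded below by min(sigma, rho mu/L), each such cluster point
   satisfies Minty's inequality <F(z),z-p> >= 0 on C and so is a solution. By
   Opial's argument all these cluster points agree. *)

Set Implicit Arguments.
Unset Strict Implicit.
Unset Printing Implicit Defensive.

Import Order.TTheory GRing.Theory Num.Theory.
Import numFieldNormedType.Exports.

Local Open Scope classical_set_scope.
Local Open Scope ring_scope.

(** * First-order conditions along segments *)

Lemma ge0_of_quadratic (R : realFieldType) (a b : R) :
  (forall t, 0 < t -> t <= 1 -> 0 <= t * a + t ^+ 2 * b) -> 0 <= a.
Proof.
move=> ab; rewrite leNgt; apply/negP => a0.
have c0 : 0 < `|b| - a + 1 by rewrite -addrA ltr_wpDl// addr_gt0 // oppr_gt0.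
(* With this choice [t] is at most 1 and a + t |b| = - t (1 - a) < 0. *)
set t := - a / (`|b| - a + 1).
have t0 : 0 < t by rewrite divr_gt0 // oppr_gt0.
have t1 : t <= 1 by rewrite ler_pdivrMr // mul1r -addrA addrCA lerDl addr_ge0.
have := ab t t0 t1.
have -> : t * a + t ^+ 2 * b = t * (a + t * b) by ring.
rewrite pmulr_rge0 // leNgt => /negP; apply.
have tb : t * b <= t * `|b| by rewrite ler_pM2l // ler_norm.
have tE : t * (`|b| - a + 1) = - a by rewrite /t mulfVK // gt_eqF.
nra.
Qed.

Lemma convex_setE (R : realType) (H : lmodType R) (C : set H) (a b : H) (t : R) :
  convex_set C -> C a -> C b -> 0 < t -> t <= 1 -> C (a + t *: (b - a)).
Proof.
move=> Cc Ca Cb t0 t1.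
have := Cc b a (Itv01 (ltW t0) t1) (mem_set Cb) (mem_set Ca).
move/set_mem; congr (C _).
change (t *: b + (1 - t) *: a = a + t *: (b - a)).
by rewrite scalerBr scalerBl scale1r addrC addrAC addrA.
Qed.

(** * Inner products, projections and the Riesz representation *)

Section HilbertSpace.
Variables (R : realType) (H : completeNormedModType R).
Variable ip : {dot H for idfun}.
Hypothesis ip_norm : induces_norm ip.

Lemma ipDl (u v w : H) : ip (u + v) w = ip u w + ip v w.
Proof. exact: linearDl. Qed.

Lemma ipDr (u v w : H) : ip w (u + v) = ip w u + ip w v.
Proof. exact: linearDr. Qed.

Lemma ipNl (u w : H) : ip (- u) w = - ip u w.
Proof. exact: linearNl. Qed.

Lemma ipNr (u w : H) : ip w (- u) = - ip w u.
Proof. exact: linearNr. Qed.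

Lemma ipZl (a : R) (u w : H) : ip (a *: u) w = a * ip u w.
Proof. exact: linearZl_LR. Qed.

Lemma ipZr (a : R) (u w : H) : ip w (a *: u) = a * ip w u.
Proof. exact: linearZr_LR. Qed.

Definition ipE := (ipDl, ipDr, ipNl, ipNr, ipZl, ipZr).

Lemma ipC (u v : H) : ip u v = ip v u.
Proof. by rewrite hermC expr0 mul1r. Qed.

Lemma sqr_normD (u v : H) : `|u + v| ^+ 2 = `|u| ^+ 2 + 2 * ip u v + `|v| ^+ 2.
Proof. by rewrite -!ip_norm !ipE (ipC v u); ring. Qed.

Lemma sqr_normB (u v : H) : `|u - v| ^+ 2 = `|u| ^+ 2 - 2 * ip u v + `|v| ^+ 2.
Proof. by rewrite -!ip_norm !ipE (ipC v u); ring. Qed.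

Lemma cauchy_schwarz (u v : H) : ip u v <= `|u| * `|v|.
Proof.
have : `|u + v| ^+ 2 <= (`|u| + `|v|) ^+ 2.
  by rewrite ler_sqr ?nnegrE ?addr_ge0 // ler_normD.
rewrite sqr_normD sqrrD; lra.
Qed.

Lemma norm_ip (u v : H) : `|ip u v| <= `|u| * `|v|.
Proof.
rewrite ler_norml cauchy_schwarz andbT lerNl -ipNl.
by rewrite (le_trans (cauchy_schwarz _ _)) // normrN.
Qed.

(** * Minimization of a quadratic functional over a closed convex set *)

Section QuadraticMinimization.
Variables (C : set H) (f : H -> R) (M : R).
Hypotheses (C0 : C !=set0) (C_closed : closed C) (C_convex : convex_set C).
Hypothesis f_linear : forall a u v, f (a *: u + v) = a * f u + f v.
Hypothesis f_bound : forall u, f u <= M * `|u|.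

Let J u : R := `|u| ^+ 2 - 2 * f u.

Let fD u v : f (u + v) = f u + f v.
Proof. by rewrite -[u in LHS]scale1r f_linear mul1r. Qed.

Let f0 : f 0 = 0.
Proof. by have := fD 0 0; rewrite addr0; lra. Qed.

Let fZ a u : f (a *: u) = a * f u.
Proof. by rewrite -[_ *: _]addr0 f_linear f0 addr0. Qed.

Let JD u v t : J (u + t *: v) = J u + t * (2 * (ip u v - f v)) + t ^+ 2 * `|v| ^+ 2.
Proof.
by rewrite /J sqr_normD fD fZ normrZ exprMn real_normK ?num_real // ipZr; ring.
Qed.

Let J_has_inf : has_inf (J @` C).
Proof.
split; first by case: C0 => c Cc; exists (J c), c.
(* Indeed |c|^2 - 2 M |c| = (|c| - M)^2 - M^2. *)
exists (- M ^+ 2) => _ [c _ <-]; rewrite /J.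
have := f_bound c; have := sqr_ge0 (`|c| - M); rewrite sqrrB; nra.
Qed.

(* The parallelogram law makes every minimizing sequence Cauchy. *)
Let J_parallelogram u v : C u -> C v ->
  `|u - v| ^+ 2 <= 2 * (J u - inf (J @` C)) + 2 * (J v - inf (J @` C)).
Proof.
move=> Cu Cv; have := @convex_setE _ _ C u v 2^-1 C_convex Cu Cv.
have [-> ->] : 0 < 2^-1 :> R /\ 2^-1 <= 1 :> R
  by rewrite invr_gt0 invf_le1 ?ler1n ?ltr0n.
move=> /(_ isT isT) Cm.
have /(ge_inf J_has_inf.2) : (J @` C) (J (u + 2^-1 *: (v - u)))
  by exists (u + 2^-1 *: (v - u)).
rewrite JD.
have -> : `|u - v| ^+ 2 = `|v - u| ^+ 2 by rewrite distrC.
have := JD u (v - u) 1; rewrite scale1r addrC subrK => ->.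
set a := ip _ _ - _; set N := `|_|; rewrite expr1n; lra.
Qed.

Let f_cvg (u : nat -> H) q : u n @[n --> \oo] --> q -> f (u n) @[n --> \oo] --> f q.
Proof.
move=> uq; apply/cvgrPdist_le => e e0.
have M0 : 0 < `|M| + 1 by rewrite ltr_wpDl.
have fM v : f v <= (`|M| + 1) * `|v|.
  rewrite (le_trans (f_bound v)) // ler_wpM2r // (le_trans (ler_norm M)) //.
  by rewrite lerDl.
near=> n.
have fB : f q - f (u n) = f (q - u n).
  by rewrite fD -[- u n]scaleN1r fZ mulN1r.
rewrite fB (@le_trans _ _ ((`|M| + 1) * `|q - u n|)) //.
  rewrite ler_norml fM andbT lerNl -mulN1r -fZ scaleN1r.
  by rewrite (le_trans (fM _)) // normrN.
rewrite -ler_pdivlMl //; near: n; apply: cvgr_dist_le => //.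
by rewrite mulr_gt0 // invr_gt0.
Unshelve. all: by end_near. Qed.

(** A minimizing sequence of [J] in [C] is Cauchy, its limit [q] minimizes [J], and the inequality
    is the first-order condition at [q]. Taking [f = ip u] yields the projection of [u], and
    [C = setT] the Riesz vector of [f]. Linearity of [f] is a plain hypothesis so that pointwise
    limits of inner products qualify. *)
Lemma quadratic_minimizer :
  exists2 q, C q & forall z, C z -> f (z - q) <= ip q (z - q).
Proof.
set d := inf (J @` C).
have n_gt0 n : 0 < n.+1%:R^-1 :> R by rewrite invr_gt0.
have /choice[u uP] : forall n : nat, exists c, C c /\ J c < d + n.+1%:R^-1.
  move=> n; have [_ [c Cc <-] ?] := inf_adherent (n_gt0 n) J_has_inf.
  by exists c.
have u_cauchy : cauchy (u @ \oo).
  apply: cauchy_exP => e e0.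
  (* By [J_parallelogram], two points where [J] exceeds its infimum by less than e^2/4 are at
     distance less than e. *)
  have e4 : 0 < e ^+ 2 / 4 by rewrite divr_gt0 ?exprn_gt0.
  have [N _ NP] := near_infty_natSinv_lt (PosNum e4).
  exists (u N), N => // n /= Nn; rewrite -ball_normE /=.
  rewrite -ltr_sqr ?nnegrE ?(ltW e0) //.
  have [CN JN] := uP N; have [Cn Jn] := uP n.
  apply: (le_lt_trans (J_parallelogram CN Cn)); rewrite -/d.
  move: JN Jn (NP N (leqnn N)) (NP n Nn) => /=.
  move: (N.+1%:R^-1) (n.+1%:R^-1) (e ^+ 2) => a b c; lra.
have /cauchy_cvgP/cvg_ex[q uq] := u_cauchy.
have Cq : C q.
  by apply: (closed_cvg C _ _ _ uq) => //; apply: nearW => n; case: (uP n).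
have Jq z : C z -> J q <= J z.
  move=> Cz; apply: (@le_trans _ _ d); last first.
    by apply: (ge_inf J_has_inf.2); exists z.
  have n0 : d + n.+1%:R^-1 @[n --> \oo] --> d.
    by rewrite -[X in _ --> X]addr0; apply: cvgD;
      [exact: cvg_cst|exact: cvg_harmonic].
  suff Ju : J (u n) @[n --> \oo] --> J q.
    by apply: (ler_cvg_to Ju n0); apply: nearW => n; apply/ltW; case: (uP n).
  apply: cvgB; last by apply: cvgMr; exact: f_cvg.
  by apply: (cvgM (cvg_norm uq) (cvg_norm uq)).
exists q => // z Cz; rewrite -subr_ge0.
suff: 0 <= 2 * (ip q (z - q) - f (z - q)) by rewrite pmulr_rge0.
apply: (@ge0_of_quadratic _ _ (`|z - q| ^+ 2)) => t t0 t1.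
have := Jq _ (convex_setE C_convex Cq Cz t0 t1).
by rewrite JD -addrA lerDl.
Qed.
End QuadraticMinimization.

(** Up to the constant |u|^2, [J] with [f = ip u] is the squared distance to [u]. So a nearest point
    exists and [xget] does not return its default; the angle inequality then follows from the
    minimality of the point that [xget] picks. *)
Lemma metric_projP (C : set H) (u : H) :
  C !=set0 -> closed C -> convex_set C ->
  C (metric_proj C u) /\
  forall z, C z -> ip (u - metric_proj C u) (z - metric_proj C u) <= 0.
Proof.
move=> C0 Ccl Cco.
have [|v|q Cq qP] := @quadratic_minimizer C (ip u) `|u| C0 Ccl Cco.
- by move=> a v w; rewrite !ipE.
- exact: cauchy_schwarz.
have [CP Pmin] : C (metric_proj C u) /\
    forall z, C z -> `|u - metric_proj C u| <= `|u - z|.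
  apply: (@xgetPex _ 0 [set p | C p /\ forall z, C z -> `|u - p| <= `|u - z|]).
  exists q; split=> // z Cz.
  rewrite -ler_sqr ?nnegrE //.
  have -> : u - z = (u - q) - (z - q) by rewrite opprB addrA subrK.
  rewrite [X in _ <= X]sqr_normB ipDl ipNl.
  by have := qP z Cz; have := sqr_ge0 `|z - q|; lra.
split=> // z Cz; set P := metric_proj C u in CP Pmin *.
rewrite -oppr_ge0 -(@pmulr_rge0 _ 2) //.
apply: (@ge0_of_quadratic _ _ (`|z - P| ^+ 2)) => t t0 t1.
have := Pmin _ (convex_setE Cco CP Cz t0 t1).
rewrite -ler_sqr ?nnegrE // opprD addrA [X in _ <= X]sqr_normB ipZr normrZ.
by rewrite exprMn real_normK ?num_real //; lra.
Qed.

(** On the whole space the first-order condition can be tested at q + h and at q - h, which turns it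
    into an equality. *)
Lemma riesz_representation (f : H -> R) (M : R) :
  (forall a u v, f (a *: u + v) = a * f u + f v) ->
  (forall u, f u <= M * `|u|) -> exists q, forall h, f h = ip q h.
Proof.
move=> fL fM.
have [| | |q _ qP] := @quadratic_minimizer setT f M _ _ _ fL fM.
- by exists 0.
- exact: closedT.
- by move=> *; rewrite inE.
have fN h : f (- h) = - f h.
  have f0 : f 0 = 0 by have := fL 1 0 0; rewrite scale1r addr0; lra.
  by rewrite -[- h]addr0 -scaleN1r fL f0; ring.
exists q => h; apply/eqP; rewrite eq_le; apply/andP; split.
  by have := qP (q + h) I; rewrite addrC addKr.
have := qP (q - h) I; rewrite addrAC subrr add0r fN ipNr; lra.
Qed.

(** Weak convergence tested on inner products, along any filter so that ultrafilters are covered. *)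
Definition ip_cvg (T : Type) (U : set_system T) (x : T -> H) (p : H) :=
  forall h, ip (x t) h @[t --> U] --> ip p h.

(** With [q] the projection of [p], the inequality <p - q, x_t - q> <= 0 becomes |p - q|^2 <= 0 in
    the limit. *)
Lemma closed_convex_ip_cvg (T : Type) (U : set_system T) (UU : ProperFilter U)
    (C : set H) (x : T -> H) (p : H) :
  closed C -> convex_set C -> (forall t, C (x t)) -> ip_cvg U x p -> C p.
Proof.
move=> Ccl Cco Cx xp.
have C0 : C !=set0 by have [t _] := filter_ex (@filterT _ U _); exists (x t).
have [CP PP] := metric_projP p C0 Ccl Cco; set q := metric_proj C p in CP PP.
suff : `|p - q| ^+ 2 <= 0.
  by rewrite exprn_even_le0 //= normr_eq0 subr_eq0 => /eqP ->.
rewrite -ip_norm [ip (p - q) _]ipDl ipNl subr_le0.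
apply: (cvgr_to_le (xp (p - q))); apply: filterE => t.
by rewrite -subr_le0 -ipNl -ipDl ipC PP.
Qed.

End HilbertSpace.

(** * Limits along ultrafilters *)

Lemma ultra_cvg_bounded (R : realType) (T : Type) (U : set_system T)
    (g : T -> R) (M : R) :
  UltraFilter U -> (forall t, `|g t| <= M) -> exists l : R, g t @[t --> U] --> l.
Proof.
move=> UU gM.
have gitv : (g @ U) [set` `[- M, M]].
  by apply: nearW => t /=; rewrite in_itv /= -ler_norml.
have [l [_ lcl]] := @segment_compact R (- M) M (g @ U) _ gitv.
(* A cluster point of an ultrafilter is a limit: otherwise the complement of the neighbourhood [V]
   would have to meet [V]. *)
exists l => V Vl; have [//|UV] := in_ultra_setVsetC (g @^-1` V) UU.
by have [y [nVy Vy]] := lcl (~` V) V UV Vl.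
Qed.

(** If the preimage of a neighbourhood were not in [F], then [F] restricted to its complement would
    be proper, and an ultrafilter refining it would contain both sets. *)
Lemma cvg_ultra (T : Type) (F : set_system T) (FF : Filter F)
    (V : topologicalType) (f : T -> V) (l : V) :
  (forall U, UltraFilter U -> F `<=` U -> f t @[t --> U] --> l) ->
  f t @[t --> F] --> l.
Proof.
move=> UP A Al; apply: contrapT => nFA.
have pF : ProperFilter (within (~` (f @^-1` A)) F).
  apply: Build_ProperFilter; rewrite /within /= => F0; apply: nFA.
  by apply: filterS F0 => t /contrapT.
have [U [UU sU]] := ultraFilterLemma pF.
have UA : U (f @^-1` A).
  apply: (UP U UU _ A Al) => B FB; apply: sU; exact: (filterS _ FB).
have UnA : U (~` (f @^-1` A)) by apply: sU; exact: withinT.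
by have [t [? ?]] := filter_ex (filterI UA UnA).
Qed.

(** * Weak cluster points, Opial's argument and Minty's inequality *)

Section WeakLimits.
Variables (R : realType) (H : completeNormedModType R).
Variable ip : {dot H for idfun}.
Hypothesis ip_norm : induces_norm ip.

(** This takes the place of extracting a weakly convergent subsequence. *)
Lemma bounded_ultra_ip_cvg (T : Type) (U : set_system T) (x : T -> H) (M : R) :
  UltraFilter U -> (forall t, `|x t| <= M) -> exists p, ip_cvg ip U x p.
Proof.
move=> UU xM.
have bnd h t : `|ip (x t) h| <= M * `|h|.
  by rewrite (le_trans (norm_ip ip_norm _ _)) // ler_wpM2r.
have /choice[f fP] : forall h, exists l : R, ip (x t) h @[t --> U] --> l.
  by move=> h; exact: ultra_cvg_bounded (bnd h).
have [| |q qP] := @riesz_representation _ _ ip ip_norm f M.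
- move=> a u v; apply: (cvg_unique _ (fP _)) => //=.
  rewrite (_ : (fun t => _) = (fun t => a * ip (x t) u + ip (x t) v)).
    by apply: cvgD => //; apply: cvgMr.
  by apply/funext => t; rewrite !ipE.
- move=> u; apply: (cvgr_to_le (fP u)); apply: filterE => t.
  exact: le_trans (ler_norm _) (bnd u t).
by exists q => h; rewrite -qP.
Qed.

Lemma ip_cvg_weakly_cvg (x : nat -> H) (p : H) :
  ip_cvg ip \oo x p -> weakly_cvg x p.
Proof.
move=> xp f /linear_bounded_continuous /linear_boundedP fb.
have [M _ fM] := pinfty_ex_gt0 fb.
have [||q qP] := @riesz_representation _ _ ip ip_norm f M.
- by move=> a u v; rewrite linearP.
- by move=> u; rewrite (le_trans (ler_norm _)).
rewrite (_ : (fun k => _) = (fun k => ip (x k) q)) ?qP 1?ipC; first exact: xp.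
by apply/funext => k; rewrite qP ipC.
Qed.

(** If p and q are limits along two ultrafilters, both lie in [S], so <x_k, p - q> converges along
    [\oo]. Its limit equals both <p, p - q> and <q, p - q>, whence p = q, and [cvg_ultra]
    applies. *)
Lemma opial (S : set H) (x : nat -> H) : S !=set0 ->
  (forall p, S p -> cvgn (fun k => `|x k - p|)) ->
  (forall U p, UltraFilter U -> \oo `<=` U -> ip_cvg ip U x p -> S p) ->
  exists2 p, S p & weakly_cvg x p.
Proof.
move=> [s Ss] fejer clS.
have [M xM] : exists M, forall k, `|x k| <= M.
  have /cvg_seq_bounded/pinfty_ex_gt0[M _ sM] := fejer s Ss.
  exists (M + `|s|) => k; rewrite -[x k](subrK s) (le_trans (ler_normD _ _)) //.
  by rewrite lerD2r; have := sM k I; rewrite /= normr_id.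
have [U [UU oU]] := @ultraFilterLemma nat \oo _.
have [p xp] := bounded_ultra_ip_cvg UU xM.
have Sp := clS U p UU oU xp; exists p => //.
apply: ip_cvg_weakly_cvg => h; apply: cvg_ultra => V VV oV.
have [q xq] := bounded_ultra_ip_cvg VV xM.
have Sq := clS V q VV oV xq.
suff -> : p = q by exact: xq.
(* [2 ip (x k) (p - q) = |x k - q|^2 - |x k - p|^2 + |p|^2 - |q|^2] converges. *)
have [l xl] : exists l : R, ip (x k) (p - q) @[k --> \oo] --> l.
  have cp := fejer p Sp; have cq := fejer q Sq.
  have -> : (fun k => ip (x k) (p - q)) = (fun k => 2^-1 *
      ((`|x k - q| ^+ 2 - `|x k - p| ^+ 2) + (`|p| ^+ 2 - `|q| ^+ 2))).
    by apply/funext => k; rewrite !(sqr_normB ip_norm) !ipE; field.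
  eexists; apply: cvgMr; apply: cvgD; last exact: cvg_cst.
  by apply: cvgB; [exact: (cvgM cq cq)|exact: (cvgM cp cp)].
have lp : ip p (p - q) = l.
  by apply: (cvg_unique _ (xp _)) => //; apply: cvg_trans xl; exact: cvg_app oU.
have lq : ip q (p - q) = l.
  by apply: (cvg_unique _ (xq _)) => //; apply: cvg_trans xl; exact: cvg_app oV.
apply/eqP; rewrite -subr_eq0 -normr_eq0 -sqrf_eq0 -ip_norm.
by rewrite [ip _ (p - q)]ipDl ipNl lp lq subrr.
Qed.

(** The hypothesis is affine in [p], which is the form that survives weak limits. Testing it at p +
    t (z - p) and replacing [F] there by [F p] costs only t^2 L |z - p|^2. *)
Lemma minty (C : set H) (F : H -> H) (L : R) (p : H) :
  convex_set C -> 0 < L -> L.-lipschitz_C F -> C p ->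
  (forall z, C z -> 0 <= ip (F z) (z - p)) -> VI_sol ip C F p.
Proof.
move=> Cco L0 FL Cp FP; split=> // z Cz.
apply: (@ge0_of_quadratic _ _ (L * `|z - p| ^+ 2)) => t t0 t1.
have Ct := convex_setE Cco Cp Cz t0 t1.
have := FP _ Ct; set w := p + _ in Ct *.
have wp : w - p = t *: (z - p) by rewrite /w addrC addKr.
have /= := FL (w, p) (conj Ct Cp); rewrite wp normrZ gtr0_norm // => Fw.
rewrite ipZr pmulr_rge0 // -[F w](subrK (F p)) ipDl => Fp.
have := cauchy_schwarz ip_norm (F w - F p) (z - p).
have -> : t * ip (F p) (z - p) + t ^+ 2 * (L * `|z - p| ^+ 2) =
  t * (ip (F p) (z - p) + L * (t * `|z - p|) * `|z - p|) by ring.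
move=> cs; rewrite pmulr_rge0 // (le_trans Fp) // addrC lerD2l.
by rewrite (le_trans cs) // ler_wpM2r.
Qed.

End WeakLimits.

(** * Real sequences with summable perturbations *)

Lemma summable_bounded (R : realType) (e : nat -> R) :
  (forall k, 0 <= e k) -> cvgn (series e) -> exists M, forall n, series e n <= M.
Proof.
move=> e0 /cvg_seq_bounded/bounded_fun_has_ubound[M eM].
by exists M => n; apply: eM; exists n.
Qed.

(** Subtracting the partial sums of [e] from [a] leaves a nonincreasing sequence that is bounded
    below. *)
Lemma quasi_fejer_cvg (R : realType) (a e : nat -> R) :
  (forall k, 0 <= a k) -> (forall k, 0 <= e k) -> cvgn (series e) ->
  (forall k, a k.+1 <= a k + e k) -> cvgn a.
Proof.
move=> a0 e0 ce ae.
have -> : a = (fun n => (a n - series e n) + series e n).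
  by apply/funext => n; rewrite subrK.
apply: is_cvgD => //; apply: nonincreasing_is_cvgn.
  apply/nonincreasing_seqP => n; rewrite seriesSr /=; have := ae n; lra.
have [M eM] := summable_bounded e0 ce.
by exists (- M) => _ [n _ <-]; have := eM n; have := a0 n; lra.
Qed.

(** Complete the square: (a' - v)^2 <= a^2 + u^2 + v^2 <= (a + u + v)^2. This turns an estimate on
    squares into the additive form used by [quasi_fejer_cvg]. *)
Lemma sqr_perturbation_bound (R : realFieldType) (a a' u v : R) :
  0 <= a -> 0 <= u -> 0 <= v -> a' ^+ 2 <= a ^+ 2 + u ^+ 2 + 2 * v * a' ->
  a' <= a + u + 2 * v.
Proof.
move=> a0 u0 v0 H; rewrite leNgt; apply/negP => lt.
have av : a + u + v < a' - v by lra.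
have : (a + u + v) ^+ 2 < (a' - v) ^+ 2 by rewrite ltr_sqr ?nnegrE; lra.
have : 0 <= a * u by rewrite mulr_ge0.
have : 0 <= a * v by rewrite mulr_ge0.
have : 0 <= u * v by rewrite mulr_ge0.
rewrite !expr2 in H *; lra.
Qed.

(** * Estimates for a single extragradient step *)

Section ExtragradientStep.
Variables (R : realType) (H : completeNormedModType R).
Variable ip : {dot H for idfun}.
Hypothesis ip_norm : induces_norm ip.
Variables (C : set H) (F : H -> H) (mu : R).
Hypotheses (C0 : C !=set0) (C_closed : closed C) (C_convex : convex_set C).
Hypotheses (F_monotone : monotone_on ip C F) (mu_range : 0 < mu < 1).
Variables (g : R) (x y x' e1 e2 : H).
Hypotheses (g0 : 0 < g) (Cx : C x).
Hypothesis yE : y = metric_proj C (x - g *: F x + e1).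
Hypothesis accepted : g * `|F x - F y| <= mu * `|x - y|.
Hypothesis x'E : x' = metric_proj C (x - g *: F y + e2).

Let proj_ineq u : C (metric_proj C u) /\
  forall z, C z -> ip (u - metric_proj C u) (z - metric_proj C u) <= 0.
Proof. exact: metric_projP. Qed.

(** The projection inequality at [y] is tested at [x'], the one at [x'] is tested at [p]. Since <F
    y, y - p> >= 0, only g <F x - F y, x' - y> remains of the [F] terms, and the acceptance test
    controls it. *)
Lemma eg_step_sqr_estimate p : VI_sol ip C F p ->
  `|x' - p| ^+ 2 + (1 - mu) * `|x - y| ^+ 2 <=
  `|x - p| ^+ 2 + (1 - mu)^-1 * `|e1| ^+ 2 + 2 * `|e2| * `|x' - p|.
Proof.
move=> [Cp Fp]; case/andP: mu_range => mu0 mu1.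
have [Cy Py] := proj_ineq (x - g *: F x + e1); rewrite -yE in Cy Py.
have [Cx' Px'] := proj_ineq (x - g *: F y + e2); rewrite -x'E in Cx' Px'.
have Fyp : 0 <= g * ip (F y) (y - p).
  apply: mulr_ge0; first exact: ltW.
  by have := F_monotone Cy Cp; have := Fp _ Cy; rewrite ipDl ipNl; lra.
have Fxy : g * ip (F x - F y) (x' - y) <= mu * (`|x - y| * `|x' - y|).
  apply: (@le_trans _ _ (g * (`|F x - F y| * `|x' - y|))).
    by rewrite ler_pM2l //; exact: cauchy_schwarz.
  by rewrite !mulrA ler_wpM2r.
have e1x' : - ip e1 (x' - y) <= `|e1| * `|x' - y|.
  by rewrite -ipNl (le_trans (cauchy_schwarz ip_norm _ _)) // normrN.
have e2x' := cauchy_schwarz ip_norm e2 (x' - p).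
have amgm : mu * (`|x - y| * `|x' - y|) <=
    mu * ((`|x - y| ^+ 2 + `|x' - y| ^+ 2) / 2).
  rewrite ler_pM2l //; have := sqr_ge0 (`|x - y| - `|x' - y|); rewrite sqrrB; lra.
have nu0 : 0 < 1 - mu by lra.
(* The weight is chosen so that the last term is exactly the (1 - mu) |x' - y|^2 left over after
   [amgm]. *)
have young : 2 * (`|e1| * `|x' - y|) <=
    (1 - mu)^-1 * `|e1| ^+ 2 + (1 - mu) * `|x' - y| ^+ 2.
  rewrite -subr_ge0 (_ : _ - _ = (1 - mu)^-1 * (`|e1| - (1 - mu) * `|x' - y|) ^+ 2).
    by rewrite mulr_ge0 ?sqr_ge0 // invr_ge0 ltW.
  by field; rewrite gt_eqF.
have Qy := Py _ Cx'; have Qx' := Px' _ Cp.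
have sxp := sqr_normB ip_norm x p; have sx'p := sqr_normB ip_norm x' p.
have sxy := sqr_normB ip_norm x y; have sx'y := sqr_normB ip_norm x' y.
rewrite !ipE in Qy Qx' Fyp Fxy e1x' e2x'.
rewrite -!ip_norm in sxp sx'p sxy sx'y amgm young *.
(* Up to symmetry of [ip], the claim is now a linear combination of the facts collected. *)
have c1 := ipC ip y x; have c2 := ipC ip x' x; have c3 := ipC ip x' y.
have c4 := ipC ip p x; have c5 := ipC ip p y; have c6 := ipC ip p x'.
lra.
Qed.

Lemma eg_step_quasi_fejer p : VI_sol ip C F p ->
  `|x' - p| <= `|x - p| + ((1 - mu)^-1 * `|e1| + 2 * `|e2|).
Proof.
move=> Sp; case/andP: mu_range => mu0 mu1; rewrite addrA.
(* A factor of at least 1 is below its square, so u = (1 - mu)^-1 |e1| can be used in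
   [sqr_perturbation_bound]. *)
have nu1 : 1 <= (1 - mu)^-1 by rewrite invf_ge1; lra.
apply: sqr_perturbation_bound => //.
  by rewrite mulr_ge0 // (le_trans _ nu1).
apply: (le_trans _ (le_trans (eg_step_sqr_estimate Sp) _)).
  by rewrite lerDl mulr_ge0 ?sqr_ge0 //; lra.
rewrite lerD2r lerD2l exprMn ler_wpM2r ?sqr_ge0 //.
by rewrite expr2 ler_peMl // (le_trans _ nu1).
Qed.

(** Bounds the violation of Minty's inequality at [x] by a quantity that vanishes with |x - y| and
    |e1|, uniformly in the stepsize. By monotonicity <F z, x - z> <= <F x, x - y> - <F x, z - y>,
    and the projection inequality at [y] handles the last term. *)
Lemma eg_step_residual L g1 z : L.-lipschitz_C F -> 0 < g1 <= g -> C z ->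
  ip (F z) (x - z) <=
  g1^-1 * ((`|x - y| + `|e1|) * (`|x - z| + `|x - y|)) +
  (`|F z| + L * `|x - z|) * `|x - y|.
Proof.
move=> FL /andP[g10 g1g] Cz.
have [Cy Py] := proj_ineq (x - g *: F x + e1); rewrite -yE in Cy Py.
have Qz := Py _ Cz.
have yz : `|z - y| <= `|x - z| + `|x - y|.
  by rewrite (distrC x z) (le_trans _ (ler_normD _ _)) // addrA subrK.
have Fx : `|F x| <= `|F z| + L * `|x - z|.
  have /= FLxz := FL (x, z) (conj Cx Cz).
  by rewrite -[F x](subrK (F z)) (le_trans (ler_normD _ _)) // addrC lerD2l.
have I1 : - ip (F x) (z - y) <= g1^-1 * ((`|x - y| + `|e1|) * (`|x - z| + `|x - y|)).
  have cs := cauchy_schwarz ip_norm (- (x - y + e1)) (z - y).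
  have n1 : `|- (x - y + e1)| <= `|x - y| + `|e1| by rewrite normrN ler_normD.
  have : - (g * ip (F x) (z - y)) <= (`|x - y| + `|e1|) * (`|x - z| + `|x - y|).
    apply: (@le_trans _ _ (`|- (x - y + e1)| * `|z - y|)); last exact: ler_pM.
    by apply: le_trans cs; move: Qz; rewrite !ipE; lra.
  rewrite -mulrN mulrC -ler_pdivlMr // => /le_trans; apply.
  rewrite mulrC ler_wpM2r ?mulr_ge0 ?addr_ge0 //.
  by rewrite lef_pV2 // posrE.
have I2 : ip (F x) (x - y) <= (`|F z| + L * `|x - z|) * `|x - y|.
  by rewrite (le_trans (cauchy_schwarz ip_norm _ _)) // ler_wpM2r.
have := F_monotone Cx Cz; move: I1 I2; rewrite !ipE; lra.
Qed.

End ExtragradientStep.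

(** * Lower bound for the stepsizes *)

Section ExtragradientMethod.
Variables (R : realType) (H : completeNormedModType R).
Variable ip : {dot H for idfun}.
Hypothesis ip_norm : induces_norm ip.
Variables (C : set H) (F : H -> H) (L sigma rho mu : R).
Hypotheses (C0 : C !=set0) (C_closed : closed C) (C_convex : convex_set C).
Hypotheses (L_gt0 : 0 < L) (F_lipschitz : L.-lipschitz_C F).
Hypotheses (sigma_gt0 : 0 < sigma) (rho_range : 0 < rho < 1) (mu_range : 0 < mu < 1).

Let proj_in u : C (metric_proj C u).
Proof. by have [] := metric_projP ip_norm u C0 C_closed C_convex. Qed.

Lemma eg_stepsize_gt0 m : 0 < eg_stepsize sigma rho m.
Proof. by case/andP: rho_range => ? _; rewrite mulr_gt0 // exprn_gt0. Qed.

(** For m > 0 the preceding trial, with stepsize larger by the factor 1/rho, was rejected; by the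
    Lipschitz condition that stepsize exceeds mu/L. *)
Lemma eg_stepsize_lower_bound x e m : C x ->
  (forall j, (j < m)%N -> ~~ eg_accept C F sigma rho mu x e j) ->
  Num.min sigma (rho * mu / L) <= eg_stepsize sigma rho m.
Proof.
move=> Cx; case: m => [_|m /(_ m (ltnSn m))].
  by rewrite /eg_stepsize expr0 mulr1 ge_min lexx.
case/andP: rho_range => rho0 _; case/andP: mu_range => mu0 _.
rewrite /eg_accept -ltNge; set y := eg_trial _ _ _ _ _ _ _ => rej.
rewrite ge_min; apply/orP; right.
rewrite ler_pdivrMr // /eg_stepsize exprS mulrCA -mulrA ler_pM2l //.
rewrite -/(eg_stepsize sigma rho m).
have /= Fxy := F_lipschitz (conj Cx (proj_in _) : (C `*` C) (x, y)).
(* If x = y, both sides of the test vanish and the trial would have been accepted. *)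
have xy0 : 0 < `|x - y|.
  rewrite lt_neqAle normr_ge0 andbT; apply/negP => /eqP d0; move: rej Fxy.
  rewrite -d0 !mulr0 => /[swap]; rewrite normr_le0 => /eqP ->.
  by rewrite normr0 mulr0 ltxx.
apply/ltW; rewrite -(ltr_pM2r xy0); apply: (lt_le_trans rej).
by rewrite -[leRHS]mulrA ler_pM2l // eg_stepsize_gt0.
Qed.

End ExtragradientMethod.

(** * Weak convergence of the method *)

Unset Implicit Arguments.

Theorem theorem3p7 (R : realType) (H : completeNormedModType R)
    (ip : {dot H for idfun}) (ip_norm : induces_norm ip)
    (C : set H) (C_nonempty : C !=set0) (C_closed : closed C)
    (C_convex : convex_set C)
    (F : H -> H)
    (sol_nonempty : VI_sol ip C F !=set0)
    (F_monotone : monotone_on ip C F)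
    (L : R) (L_gt0 : 0 < L) (F_lipschitz : L.-lipschitz_C F)
    (sigma rho mu : R) (sigma_gt0 : 0 < sigma)
    (rho_range : 0 < rho < 1) (mu_range : 0 < mu < 1)
    (e1 e2 x : nat -> H)
    (e1_summable : summable_norms e1) (e2_summable : summable_norms e2)
    (x_generated : eg_generated C F sigma rho mu e1 e2 x) :
  exists2 p : H, VI_sol ip C F p & weakly_cvg x p.
Proof.
have [mu0 mu1] := andP mu_range; have [rho0 rho1] := andP rho_range.
case: x_generated => Cx0 steps.
have proj_in u : C (metric_proj C u).
  by have [] := metric_projP ip_norm u C_nonempty C_closed C_convex.
have Cx k : C (x k) by case: k => [//|k]; have [m [_ _ _ ->]] := steps k.
set g1 := Num.min sigma (rho * mu / L).
have g1_gt0 : 0 < g1 by rewrite lt_min sigma_gt0 /= divr_gt0 // mulr_gt0.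
(* Of the line search, only acceptance and the uniform lower bound [g1] are kept. *)
have /choice[y yP] : forall k, exists y, exists2 g, g1 <= g &
    [/\ y = metric_proj C (x k - g *: F (x k) + e1 k),
        g * `|F (x k) - F y| <= mu * `|x k - y| &
        x k.+1 = metric_proj C (x k - g *: F y + e2 k)].
  move=> k; have [m [acc rej _ xE]] := steps k.
  exists (eg_trial C F sigma rho (x k) (e1 k) m), (eg_stepsize sigma rho m) => //.
  exact: eg_stepsize_lower_bound rej.
pose eps k := (1 - mu)^-1 * `|e1 k| + 2 * `|e2 k|.
have nu0 : 0 < (1 - mu)^-1 by rewrite invr_gt0; lra.
have eps_summable : cvgn (series eps).
  rewrite (_ : series eps = (fun n => (1 - mu)^-1 * [normed series e1] n +
      2 * [normed series e2] n)).
    by apply: is_cvgD; apply: is_cvgMr.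
  apply/funext => n.
  by rewrite /series /= big_split /= -!mulr_sumr.
have dist_cvg p : VI_sol ip C F p -> cvgn (fun k => `|x k - p|).
  move=> Sp; apply: (quasi_fejer_cvg (e := eps)) => // k.
    by rewrite addr_ge0 ?mulr_ge0 // ltW.
  have [g gg1 [yE acc xE]] := yP k.
  exact: (eg_step_quasi_fejer ip_norm C_nonempty C_closed C_convex F_monotone
    mu_range (lt_le_trans g1_gt0 gg1) yE acc xE Sp).
have e1_0 : `|e1 k| @[k --> \oo] --> 0 by exact: cvg_series_cvg_0 e1_summable.
have e2_0 : `|e2 k| @[k --> \oo] --> 0 by exact: cvg_series_cvg_0 e2_summable.
have residual_0 : `|x k - y k| @[k --> \oo] --> 0.
  have [p Sp] := sol_nonempty; have cp := dist_cvg p Sp.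
  set l := limn (fun k => `|x k - p|) in cp.
  have cp1 : `|x k.+1 - p| @[k --> \oo] --> l.
    by have := cp; rewrite -[X in X -> _](cvg_shiftS (fun k => `|x k - p|)).
  (* Squeeze with the one-step estimate: consecutive distances to [p] share the limit [l], and the
     perturbation terms vanish. *)
  have sqr_0 : `|x k - y k| ^+ 2 @[k --> \oo] --> 0.
    apply: (squeeze_cvgr (f := fun=> 0) (h := fun k => (1 - mu)^-1 *
        (`|x k - p| ^+ 2 - `|x k.+1 - p| ^+ 2 + (1 - mu)^-1 * `|e1 k| ^+ 2 +
         2 * `|e2 k| * `|x k.+1 - p|))).
    - apply: nearW => k; rewrite sqr_ge0 /= ler_pdivlMl; last by lra.
      have [g gg1 [yE acc xE]] := yP k.
      have := eg_step_sqr_estimate ip_norm C_nonempty C_closed C_convex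
        F_monotone mu_range (lt_le_trans g1_gt0 gg1) yE acc xE Sp; lra.
    - exact: cvg_cst.
    - rewrite [X in _ --> X](_ : _ = (1 - mu)^-1 * (l * l - l * l +
        (1 - mu)^-1 * (0 * 0) + 2 * 0 * l)); last by ring.
      apply: cvgMr; apply: cvgD; last by apply: cvgM => //; apply: cvgMr.
      apply: cvgD; last by apply: cvgMr; exact: cvgM.
      by apply: cvgB; exact: cvgM.
  rewrite (_ : (fun k => _) = (fun k => Num.sqrt (`|x k - y k| ^+ 2))).
    by rewrite -[X in _ --> X]sqrtr0; apply: continuous_cvg => //;
      exact: sqrt_continuous.
  by apply/funext => k; rewrite sqrtr_sqr normr_id.
apply: (opial ip_norm sol_nonempty dist_cvg) => U p UU oU xp.
have Cp : C p by apply: closed_convex_ip_cvg xp.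
apply: (minty ip_norm C_convex L_gt0 F_lipschitz Cp) => z Cz.
have [s Ss] := sol_nonempty.
(* A uniform [M] replaces |x_k - z| in the residual bound, which then tends to 0. *)
have [M xM] : exists M, forall k, `|x k - z| <= M.
  have /cvg_seq_bounded/pinfty_ex_gt0[M _ sM] := dist_cvg s Ss.
  exists (M + `|s - z|) => k; rewrite -[x k](subrK s) -addrA.
  rewrite (le_trans (ler_normD _ _)) //.
  by rewrite lerD2r; have := sM k I; rewrite /= normr_id.
have bound_0 : g1^-1 * ((`|x k - y k| + `|e1 k|) * (M + `|x k - y k|)) +
    (`|F z| + L * M) * `|x k - y k| @[k --> \oo] --> (0 : R).
  rewrite [X in _ --> X](_ : _ =
    g1^-1 * ((0 + 0) * (M + 0)) + (`|F z| + L * M) * 0); last by ring.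
  apply: cvgD; apply: cvgMr => //; apply: cvgM; apply: cvgD => //; exact: cvg_cst.
(* The residual bound is rearranged with [x k] as first argument, as [ip_cvg] requires; its limit
   along [U] is Minty's inequality for [p]. *)
have xb k : ip (x k) (F z) <= ip z (F z) +
    (g1^-1 * ((`|x k - y k| + `|e1 k|) * (M + `|x k - y k|)) +
     (`|F z| + L * M) * `|x k - y k|).
  have [g gg1 [yE acc xE]] := yP k.
  have g1g : 0 < g1 <= g by rewrite g1_gt0.
  have := eg_step_residual ip_norm C_nonempty C_closed C_convex F_monotone
    (lt_le_trans g1_gt0 gg1) (Cx k) yE F_lipschitz g1g Cz.
  rewrite ipDr ipNr ![ip (F z) _]ipC lerBlDl => /le_trans; apply.
  rewrite lerD2l lerD //.
    by rewrite ler_pM2l ?invr_gt0 // ler_wpM2l ?addr_ge0 // lerD2r.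
  by rewrite ler_wpM2r // lerD2l ler_pM2l.
have lim_b := cvgD (cvg_cst (F := U) (ip z (F z)))
  (cvg_trans (cvg_app _ oU) bound_0).
rewrite ipDr ipNr ![ip (F z) _]ipC subr_ge0 -[leRHS]addr0.
by apply: (ler_cvg_to (xp (F z)) (lim_b _ _)); exact: filterE.
Qed.
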